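(* Let $G=(V,A)$ be a connected digraph with $|A|=m$, and let $T=(V,\hat A)$ be an oriented spanning tree of $G$ with $\hat A\subset A$ and $|\hat A|=n\ge 1$. Let $\mathbf{M}\in\mathbb{R}^{n\times m}$ be the network matrix associated with $G$ and $T$. Then $\mathbf{M}$ is a positive spanning set for $\mathbb{R}^n$ if and only if $G$ is strongly edge-connected.
   Context: A digraph $G=(V,A)$ has a finite vertex set $V$ and a finite set $A$ of arcs (ordered pairs of vertices). It is connected if its underlying undirected graph is connected; it is strongly edge-connected (strongly connected) if for any $(u,v)\in V^2$ there is a directed path from $u$ to $v$. An oriented spanning tree of $G$ is a digraph $T=(V,\hat A)$ with $\hat A\subset A$ whose underlying undirected graph is a tree. Network matrix: write $A=\{(u_j,v_j)\}_{j=1}^m$ and $\hat A=\{(\hat u_i,\hat v_i)\}_{i=1}^n$ (arbitrary fixed orderings). The network matrix of $G$ and $T$ is $\mathbf{M}\in\mathbb{R}^{n\times m}$ where $\mathbf{M}_{i,j}=0$ if the unique (undirected) path from $u_j$ to $v_j$ in $T$ does not pass through $(\hat u_i,\hat v_i)$, $\mathbf{M}_{i,j}=1$ if this path traverses $(\hat u_i,\hat v_i)$ in the forward direction, and $\mathbf{M}_{i,j}=-1$ if it traverses it in the backward direction. Positive spanning set: for $\mathbf{D}\in\mathbb{R}^{n\times m}$, $\mathrm{pspan}(\mathbf{D})=\{\mathbf{D}\mathbf{x} : \mathbf{x}\in\mathbb{R}^m,\ \mathbf{x}\ge \mathbf{0}\}$; $\mathbf{D}$ is a positive spanning set (PSS)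 of a linear subspace $\mathbb{L}\subset\mathbb{R}^n$ if $\mathrm{pspan}(\mathbf{D})=\mathbb{L}$. *)

(* Defs.v *)
From HB Require Import structures.
From mathcomp Require Import all_boot all_order all_algebra.
From mathcomp Require Import classical_sets reals.

Set Implicit Arguments.
Unset Strict Implicit.
Unset Printing Implicit Defensive.

Import Order.TTheory GRing.Theory Num.Theory.

Local Open Scope ring_scope.

(* A digraph on the finite vertex set V is given by its set of arcs.  There
   are no parallel arcs; loops (u, u) and antiparallel pairs are allowed. *)
Definition digraph (V : finType) := {set V * V}.

Section Digraphs.
Variable V : finType.
Implicit Types (A T : digraph V) (u v : V).

Definition arc_rel A : rel V := fun u v => (u, v) \in A.

Definition edge_rel A : rel V := fun u v => ((u, v) \in A) || ((v, u) \in A).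

Definition connected_digraph A : Prop := forall u v, connect (edge_rel A) u v.

Definition strongly_connected A : Prop := forall u v, connect (arc_rel A) u v.

(* The first clause says that T has neither loops nor antiparallel arcs, so
   that arcs of T correspond one-to-one to edges of its underlying undirected
   graph; this graph is then simple, and its cycles are the duplicate-free
   cyclic vertex sequences of size at least 3. *)
Definition oriented_tree T : Prop :=
  [/\ forall u v, (u, v) \in T -> (v, u) \notin T,
      connected_digraph T
    & forall c : seq V, ucycle (edge_rel T) c -> (size c <= 2)%N].

Definition oriented_spanning_tree A T : Prop := T \subset A /\ oriented_tree T.

(* As in path.v, the path u :: p is represented by its start u and its tail p. *)
Definition undirected_path_between T u v (p : seq V) : bool :=
  [&& path (edge_rel T) u p, last u p == v & uniq (u :: p)].

(* When T is an oriented tree, exactly one p satisfies the condition.  The bound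
   on the size of p only serves to search in a finite type: duplicate-free
   sequences have size at most #|V|. *)
Definition tree_path T u v : seq V :=
  if [pick p : #|V|.-bseq V | undirected_path_between T u v p] is Some p
  then val p else [::].

(* The ordered pairs of consecutive vertices of u :: p. *)
Definition steps u (p : seq V) : seq (V * V) := zip (u :: p) p.

Definition arc_ordering A k (a : k.-tuple (V * V)) : Prop := uniq a /\ a =i A.

Definition network_matrix (R : pzRingType) T m n
    (a : m.-tuple (V * V)) (t : n.-tuple (V * V)) : 'M[R]_(n, m) :=
  \matrix_(i < n, j < m)
    let: (u, v) := tnth a j in
    let: (x, y) := tnth t i in
    let s := steps u (tree_path T u v) in
    if (x, y) \in s then 1 else if (y, x) \in s then -1 else 0.

End Digraphs.

Definition pspan (R : realType) n m (D : 'M[R]_(n, m)) : set 'cV[R]_n :=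
  [set D *m x | x in [set x : 'cV[R]_m | forall j, 0 <= x j 0]]%classic.

Definition positive_spanning_set (R : realType) n m
    (D : 'M[R]_(n, m)) (L : {vspace 'cV[R]_n}) : Prop :=
  pspan D = [set y | y \in L]%classic.

(* Main.v *)
Require Import Defs.
From mathcomp Require Import all_boot all_order all_algebra.
From mathcomp Require Import classical_sets reals.

(** Write [df e = f y - f x] for an arc [e = (x, y)] and a potential [f] on the
    vertices.  Telescoping along tree paths gives, for the column of an arc
    [(u, v)] of the network matrix,
      [\sum_e df e * M e (u, v) = f v - f u],
    the sum being over the tree arcs [e].  If [A] is not strongly connected,
    take for [f] the indicator of the set of vertices reachable from a
    badly chosen [u]: then [df <> 0] has nonnegative scalar product with every
    column, so [- df] is not in the positive span.  Conversely, deleting [e]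
    from the tree splits it into two components; with [f] the indicator of the
    one that contains the head of [e], [df] is the unit vector at [e], whence
    [M e (u, v) = f v - f u].  So columns add up along directed walks, and walks
    between the ends of [e], in both directions, yield plus and minus the
    unit vector at [e]. *)

Set Implicit Arguments.
Unset Strict Implicit.
Unset Printing Implicit Defensive.

Import Order.TTheory GRing.Theory Num.Theory.

Local Open Scope ring_scope.

Section TreePaths.
Variable V : finType.
Implicit Types (A T : digraph V) (e : V * V).

Lemma edge_rel_sym A : symmetric (edge_rel A).
Proof. by move=> u v; rewrite /edge_rel orbC. Qed.

Lemma tree_pathP T u v :
  connected_digraph T -> undirected_path_between T u v (tree_path T u v).
Proof.
move=> /(_ u v) /connectP [p0 p0P ->]; rewrite /tree_path.
(* A failed search would overlook the duplicate-free shortening of [p0]. *)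
case: pickP => [p //|]; case/shortenP: p0P => p pP p_uniq _ no_path.
have sz_p : (size p <= #|V|)%N.
  have /card_uniqP /= card_p := p_uniq.
  by apply: leq_trans (max_card (mem (u :: p))); rewrite card_p.
by have /negP[] := negbT (no_path (Bseq sz_p)); rewrite /undirected_path_between pP eqxx.
Qed.

Definition head_side T e v := connect (edge_rel (T :\ e)) e.2 v.

(** A simple path from the head of [e] back to its tail that avoids [e] would be closed by [e] to a
    cycle of [T]. *)
Lemma head_side_tail T e : oriented_tree T -> e \in T -> ~~ head_side T e e.1.
Proof.
case: e => x y [asymT _ acyc] /= eT; apply/negP => /connectP [p0 p0P /= xE].
case/shortenP: p0P xE => p pP p_uniq _ xE.
have pT : path (edge_rel T) y p.
  by apply: sub_path pP => u v; rewrite /edge_rel !inE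
    => /orP[] /andP[_ ->]; rewrite ?orbT.
have /acyc : ucycle (edge_rel T) (y :: p).
  by rewrite /ucycle p_uniq andbT /= rcons_path pT -xE /edge_rel eT.
(* Acyclicity leaves cycles with at most two vertices: a loop or an antiparallel pair, both excluded
   by [asymT]. *)
case: p pP {p_uniq pT} xE => [_ /= xE|z [|//] /= + xE _].
  by move: (asymT _ _ eT); rewrite xE -{1}xE eT.
rewrite -xE andbT /edge_rel !inE eqxx /= orbF => /andP[_ yxT].
by move: (asymT _ _ eT); rewrite yxT.
Qed.

(** Such an arc survives the deletion of [e], so both its ends lie in one component. *)
Lemma head_side_arc T e e' :
  e' \in T -> e' != e -> head_side T e e'.1 = head_side T e e'.2.
Proof.
case: e' => x y e'T e'e; rewrite /head_side /=.
apply: same_connect_r; first exact: sym_connect_sym (edge_rel_sym _).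
by apply: connect1; rewrite /edge_rel !inE e'e e'T.
Qed.

Lemma steps_cons (u v : V) p : steps u (v :: p) = (u, v) :: steps v p.
Proof. by []. Qed.

Lemma mem_steps (u : V) p e : e \in steps u p -> (e.1 \in u :: p) && (e.2 \in u :: p).
Proof.
elim: p u => [|v p IHp] u //.
rewrite steps_cons inE => /predU1P[-> /=|/IHp /andP[e1 e2]].
  by rewrite !inE !eqxx orbT.
by rewrite ![_ \in u :: _]in_cons e1 e2 !orbT.
Qed.

End TreePaths.

Section Telescoping.
Variables (R : pzRingType) (V : finType).
Implicit Types (T : digraph V) (e : V * V) (f : V -> R).

(** An entry of the network matrix, with the tree path replaced by any list of steps so that
    induction on the path applies. *)
Definition crossing (s : seq (V * V)) e : R :=
  let: (x, y) := e in
  if (x, y) \in s then 1 else if (y, x) \in s then -1 else 0.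

Lemma crossing_cons u v p e : e.1 != e.2 -> uniq (u :: v :: p) ->
  crossing (steps u (v :: p)) e =
  (e == (u, v))%:R - (e == (v, u))%:R + crossing (steps v p) e.
Proof.
case: e => x y /= xy /andP[u_notin _]; rewrite steps_cons !inE.
(* By uniqueness no later step touches [u], so the first step cannot interfere with the nested tests
   for the others. *)
have Nu z : ((u, z) \in steps v p = false) * ((z, u) \in steps v p = false).
  by split; apply/negP => /mem_steps /andP[] /=; rewrite (negPf u_notin).
have [[-> ->]|_] := eqVneq (x, y) (u, v) => /=.
  rewrite !Nu !addr0 xpair_eqE.
  by move: u_notin; rewrite inE negb_or => /andP[/negPf-> _]; rewrite subr0.
have swap : ((y, x) == (u, v)) = ((x, y) == (v, u)) by rewrite !xpair_eqE andbC.
rewrite swap; have [[-> ->]|_] /= := eqVneq (x, y) (v, u).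
  by rewrite !Nu sub0r addr0.
by rewrite subrr add0r.
Qed.

Definition potential_diff f e := f e.2 - f e.1.

Lemma sum_potential_diff_crossing T f u p :
    (forall u v, (u, v) \in T -> (v, u) \notin T) ->
    path (edge_rel T) u p -> uniq (u :: p) ->
  \sum_(e in T) potential_diff f e * crossing (steps u p) e = f (last u p) - f u.
Proof.
move=> asymT; elim: p u => [|v p IHp] u.
  by move=> _ _; rewrite subrr big1 // => -[x y] _; rewrite /= mulr0.
move=> /= /andP[uv vp] up_uniq.
have/andP[_ vp_uniq] := up_uniq.
have delta e0 : \sum_(e in T) potential_diff f e * (e == e0)%:R
    = (e0 \in T)%:R * potential_diff f e0.
  have [e0T|e0T] := boolP (e0 \in T).
    rewrite (bigD1 e0) //= eqxx mulr1 mul1r big1 ?addr0 // => e /andP[_ /negPf->].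
    by rewrite mulr0.
  rewrite mul0r big1 // => e eT; case: eqVneq eT => [->|_ _]; last by rewrite mulr0.
  by rewrite (negPf e0T).
transitivity (\sum_(e in T) (potential_diff f e * (e == (u, v))%:R
    - potential_diff f e * (e == (v, u))%:R
    + potential_diff f e * crossing (steps v p) e)).
  apply: eq_bigr => -[x y] xyT; rewrite crossing_cons ?mulrDr ?mulrN //=.
  apply: contraTneq xyT => ->.
  by apply/negP => yyT; have := asymT _ _ yyT; rewrite yyT.
rewrite big_split sumrB /= !delta IHp //.
(* By antisymmetry exactly one of the two arcs is in [T]; if it is [(v, u)], the two signs
   cancel. *)
suff -> : ((u, v) \in T)%:R * potential_diff f (u, v)
    - ((v, u) \in T)%:R * potential_diff f (v, u) = f v - f u.
  by rewrite addrC subrKA.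
case/orP: uv => uvT; rewrite uvT (negPf (asymT _ _ uvT)) mul1r mul0r ?subr0 //.
by rewrite sub0r /potential_diff opprB.
Qed.

Lemma potential_diff_head_side T e e' : oriented_tree T -> e \in T -> e' \in T ->
  potential_diff (fun v => (head_side T e v)%:R) e' = (e' == e)%:R.
Proof.
move=> treeT eT e'T; rewrite /potential_diff.
have [->|e'e] := eqVneq e' e; last by rewrite head_side_arc // subrr.
by rewrite (negPf (head_side_tail treeT eT)) {1}/head_side connect0 subr0.
Qed.

(** Telescoping for the head-side indicator, whose difference vanishes on every tree arc but [e]. *)
Lemma crossing_tree_path T e u v : oriented_tree T -> e \in T ->
  crossing (steps u (tree_path T u v)) e =
  (head_side T e v)%:R - (head_side T e u)%:R.
Proof.
move=> treeT eT; have [asymT connT _] := treeT.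
have /and3P[pathP /eqP lastP p_uniq] := tree_pathP u v connT.
rewrite -[in RHS]lastP.
rewrite -(sum_potential_diff_crossing (fun v => (head_side T e v)%:R) asymT) //.
rewrite (bigD1 e) //= potential_diff_head_side // eqxx mul1r big1 ?addr0 //.
by move=> e' /andP[e'T /negPf e'e]; rewrite potential_diff_head_side // e'e mul0r.
Qed.

Lemma network_matrixE T m n (a : m.-tuple (V * V)) (t : n.-tuple (V * V)) i j :
  network_matrix R T a t i j =
  crossing (steps (tnth a j).1 (tree_path T (tnth a j).1 (tnth a j).2)) (tnth t i).
Proof. by rewrite mxE; case: (tnth a j). Qed.

End Telescoping.

Section PositiveSpan.
Variables (R : realType) (n m : nat) (D : 'M[R]_(n, m)).
Implicit Types y z : 'cV[R]_n.

Lemma pspan0 : pspan D 0.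
Proof. by exists 0 => [j /=|]; rewrite ?mxE ?mulmx0. Qed.

Lemma pspanD y z : pspan D y -> pspan D z -> pspan D (y + z).
Proof.
move=> [x x_ge0 <-] [x' x'_ge0 <-]; exists (x + x'); last by rewrite mulmxDr.
by move=> j; rewrite mxE addr_ge0 ?x_ge0 ?x'_ge0.
Qed.

Lemma pspanZ k y : 0 <= k -> pspan D y -> pspan D (k *: y).
Proof.
move=> k_ge0 [x x_ge0 <-]; exists (k *: x); last by rewrite scalemxAr.
by move=> j; rewrite mxE mulr_ge0 ?x_ge0.
Qed.

Lemma pspan_col j : pspan D (col j D).
Proof.
exists (delta_mx j 0) => [k /=|]; last by rewrite colE.
by rewrite mxE; apply: ler0n.
Qed.

Lemma pspan_unit_vectors :
    (forall i, pspan D (delta_mx i 0) /\ pspan D (- delta_mx i 0)) ->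
  forall y, pspan D y.
Proof.
move=> unitD y; rewrite (matrix_sum_delta y).
apply: (big_ind (pspan D)) => [||i _]; [exact: pspan0|exact: pspanD|].
rewrite big_ord1; have [pos neg] := unitD i.
have [yi|yi] := leP 0 (y i 0); first exact: pspanZ.
(* A negative coordinate is a positive multiple of the negated unit vector. *)
by rewrite -[_ *: _]opprK -scalerN -scaleNr; apply: pspanZ; rewrite // oppr_ge0 ltW.
Qed.

(** The easy half of Farkas' lemma: [c *m y] is a nonnegative combination of the entries of
    [c *m D]. *)
Lemma pspan_row_ge0 (c : 'rV[R]_n) y :
  (forall j, 0 <= (c *m D) 0 j) -> pspan D y -> 0 <= (c *m y) 0 0.
Proof.
move=> cD_ge0 [x x_ge0 <-]; rewrite mulmxA mxE.
by apply: sumr_ge0 => j _; rewrite mulr_ge0 ?x_ge0.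
Qed.

Lemma positive_spanning_set_fullP :
  positive_spanning_set D fullv <-> forall y, pspan D y.
Proof.
rewrite /positive_spanning_set; split=> [spanE y|spanD].
  by rewrite spanE /= memvf.
by apply/(@seteqP 'cV[R]_n); split=> y _ //=; rewrite memvf.
Qed.

End PositiveSpan.

Section NetworkMatrix.
Variables (R : realType) (V : finType) (A T : digraph V) (m n : nat).
Variables (a : m.-tuple (V * V)) (t : n.-tuple (V * V)).
Hypotheses (treeT : oriented_tree T).
Hypotheses (ha : arc_ordering A a) (ht : arc_ordering T t).

Local Notation M := (network_matrix R T a t).

Lemma strongly_connected_pspanT :
  strongly_connected A -> forall y, pspan M y.
Proof.
move=> strongA.
have tT i : tnth t i \in T by rewrite -ht.2 mem_tnth.
(* The column that an arc [(u, v)] would have, defined for every pair of vertices and additive under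
   concatenation of walks. *)
pose cut u v : 'cV[R]_n := \col_i
  ((head_side T (tnth t i) v)%:R - (head_side T (tnth t i) u)%:R).
have cutP u v : pspan M (cut u v).
  have /connectP [p + ->] := strongA u v.
  elim: p u => [|w p IHp] u /=.
    move=> _; suff -> : cut u u = 0 by exact: pspan0.
    by apply/colP => i; rewrite !mxE subrr.
  move=> /andP[+ /IHp cut_w]; rewrite /arc_rel -ha.2 => /tnthP[j uwE].
  suff -> : cut u (last w p) = col j M + cut w (last w p).
    by apply: pspanD => //; apply: pspan_col.
  apply/colP => i; rewrite !mxE -uwE.
  (* Splitting the tree arc lets the matrix entry reduce to [crossing]. *)
  case tE: (tnth t i) => [x y].
  rewrite -[X in _ = X + _]/(crossing R (steps u (tree_path T u w)) (x, y)).
  by rewrite crossing_tree_path -?tE // [RHS]addrC subrKA.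
have cutE i : cut (tnth t i).1 (tnth t i).2 = delta_mx i 0.
  apply/colP => k; rewrite !mxE andbT.
  have := potential_diff_head_side R treeT (tT k) (tT i).
  rewrite /potential_diff => ->.
  by rewrite eq_sym (inj_eq (tuple_uniqP _ ht.1)).
apply: pspan_unit_vectors => i; rewrite -cutE; split; first exact: cutP.
suff -> : - cut (tnth t i).1 (tnth t i).2 = cut (tnth t i).2 (tnth t i).1 by exact: cutP.
by apply/colP => k; rewrite !mxE opprB.
Qed.

Lemma pspanT_strongly_connected :
  (forall y, pspan M y) -> strongly_connected A.
Proof.
have [asymT connT _] := treeT.
move=> spanM u v.
pose f w : R := (connect (arc_rel A) u w)%:R.
pose c : 'rV[R]_n := \row_i potential_diff f (tnth t i).
have cM_ge0 j : 0 <= (c *m M) 0 j.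
  have aA : arc_rel A (tnth a j).1 (tnth a j).2.
    by rewrite /arc_rel -surjective_pairing -ha.2 mem_tnth.
  set x := (tnth a j).1 in aA *; set y := (tnth a j).2 in aA *.
  have /and3P[pathP /eqP lastP p_uniq] := tree_pathP x y connT.
  suff -> : (c *m M) 0 j = f y - f x.
    (* No arc of [A] leaves the set reachable from [u], so [f] does not decrease along [(x, y)]. *)
    rewrite subr_ge0 ler_nat /f; case ux: (connect _ u x) => //.
    by rewrite (connect_trans ux (connect1 aA)).
  rewrite -[in RHS]lastP -(sum_potential_diff_crossing f asymT pathP p_uniq).
  rewrite mxE -(eq_bigl _ _ ht.2) -big_uniq ?ht.1 //= big_tuple.
  by apply: eq_bigr => i _; rewrite network_matrixE mxE.
have c0 : c = 0.
  (* Testing against [- c^T] gives minus the sum of the squares of the entries of [c], which must be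
     nonnegative. *)
  have := pspan_row_ge0 cM_ge0 (spanM (- c^T)).
  rewrite mulmxN mxE oppr_ge0 mxE => sum_le0.
  have sq_ge0 i : 0 <= c 0 i * c^T i 0 by rewrite [c^T i 0]mxE -expr2 sqr_ge0.
  have /eqP sum0 : \sum_i c 0 i * c^T i 0 == 0 by rewrite eq_le sum_le0 sumr_ge0.
  apply/rowP => i; have := psumr_eq0P (fun i _ => sq_ge0 i) sum0 (i := i) isT.
  by rewrite !mxE => /eqP; rewrite mulf_eq0 orbb => /eqP.
have f_arc x y : (x, y) \in T -> f x = f y.
  rewrite -ht.2 => /tnthP[i xyE]; have /rowP/(_ i) := c0.
  by rewrite !mxE -xyE /potential_diff => /eqP; rewrite subr_eq0 => /eqP.
(* [f] agrees at the ends of each tree arc, hence is constant by connectedness of [T], and it is 1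
   at [u]. *)
have fE : f v = f u.
  have /connectP [p + ->] := connT u v.
  elim: p {v} (u) => //= w p IHp x /andP[xw /IHp->].
  by case/orP: xw => /f_arc.
by move/eqP: fE; rewrite /f connect0 eqr_nat; case: connect.
Qed.

End NetworkMatrix.

Theorem theorem3p1 (R : realType) (V : finType) (A T : digraph V) (m n : nat)
    (a : m.-tuple (V * V)) (t : n.-tuple (V * V))
    (hG : connected_digraph A) (hT : oriented_spanning_tree A T)
    (ha : arc_ordering A a) (ht : arc_ordering T t) (hm : #|A| = m) (hn : #|T| = n)
    (n_ge1 : (1 <= n)%N) :
  positive_spanning_set (network_matrix R T a t) fullv <-> strongly_connected A.
Proof.
have [_ treeT] := hT; split=> [spanE|strongA].
  by move/positive_spanning_set_fullP: spanE; apply: pspanT_strongly_connected.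
apply/positive_spanning_set_fullP => y.
exact: (strongly_connected_pspanT treeT ha ht strongA).
Qed.
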